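(* There is a universal constant $C$ such that for every continuous probability distribution $F$ on $\mathbf{R}^2$ with independent marginals and for every $s,\varepsilon\in(0,1)$ there exists a set $\mathcal{R}_{\mathrm{app}}(s,\varepsilon)\subset\mathcal{R}$ such that: 1. For every $R\in\mathcal{R}(s)$ there exists $R'\in\mathcal{R}_{\mathrm{app}}(s,\varepsilon)$ with $F(R\,\triangle\,R')\le\varepsilon F(R)$. 2. $\#\mathcal{R}_{\mathrm{app}}(s,\varepsilon)\le C s^{-1}\varepsilon^{-4}\log(2/s)$.
   Context: $\mathcal{R}$ denotes the set of all axis-parallel rectangles in $\mathbf{R}^2$, of arbitrary size and aspect ratio, i.e. sets $\{(u,v)\in\mathbf{R}^2: x\le u\le x',\ y\le v\le y'\}$ with $x,x',y,y'\in[-\infty,\infty]$, $x<x'$, $y<y'$. For a distribution $F$ on $\mathbf{R}^2$, $F(R)$ denotes the probability of $R$ under $F$. For $s\in(0,1)$, $\mathcal{R}(s):=\{R\in\mathcal{R}: s/2<F(R)\le s\}$. $\triangle$ is the symmetric difference, $\#$ is cardinality, and $\log$ is the natural logarithm. The constant $C$ does not depend on $F$, $s$ or $\varepsilon$; the set $\mathcal{R}_{\mathrm{app}}(s,\varepsilon)$ may depend on $F$. *)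

(* Defs.v *)
From HB Require Import structures.
From mathcomp Require Import all_boot all_order all_algebra.
From mathcomp Require Import all_classical all_reals all_analysis.
Import Order.TTheory GRing.Theory Num.Theory.
Import numFieldNormedType.Exports.

Set Implicit Arguments.
Unset Strict Implicit.
Unset Printing Implicit Defensive.

Local Open Scope classical_set_scope.
Local Open Scope ring_scope.

(* Bounds are extended reals: half-planes, strips, quadrants and the whole
   plane are rectangles; finite sides are included. *)
Definition rectangle (R : realType) (x x' y y' : \bar R) : set (R * R) :=
  [set p | (x <= p.1%:E <= x')%E /\ (y <= p.2%:E <= y')%E].

Definition rectangles (R : realType) : set (set (R * R)) :=
  [set A | exists x x' y y' : \bar R,
    [/\ (x < x')%E, (y < y')%E & A = rectangle x x' y y']].

Definition rectangles_at_scale (R : realType) (F : probability (R * R)%type R)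
    (s : R) : set (set (R * R)) :=
  [set A | rectangles A /\ ((s / 2)%:E < F A <= s%:E)%E].

Definition joint_cdf (R : realType) (F : probability (R * R)%type R)
    (p : R * R) : \bar R :=
  F (`]-oo, p.1] `*` `]-oo, p.2]).

(* A distribution is continuous when its distribution function is, jointly in
   both variables. This is strictly stronger than having no point masses, since
   it also gives measure zero to every axis-parallel line, and strictly weaker
   than having a density. *)
Definition continuous_distribution (R : realType)
    (F : probability (R * R)%type R) : Prop :=
  continuous (joint_cdf F).

Definition independent_marginals (R : realType)
    (F : probability (R * R)%type R) : Prop :=
  forall A B : set R, measurable A -> measurable B ->
    F (A `*` B) = (pushforward F fst A * pushforward F snd B)%E.

(* Main.v *)
Require Import Defs.
From HB Require Import structures.
From mathcomp Require Import all_boot all_order all_algebra.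
From mathcomp Require Import finmap.
From mathcomp Require Import ring lra.
From mathcomp Require Import all_classical all_reals all_analysis.
Import Order.TTheory GRing.Theory Num.Theory.
Import numFieldNormedType.Exports.

Local Open Scope classical_set_scope.
Local Open Scope ring_scope.

(** Independence makes the mass of a rectangle the product of the marginal
masses of its two sides, and continuity makes every level in the unit interval
a value of each marginal distribution function ([quantile]).  Measured by its
marginal distribution function, each axis thus looks like the unit interval
with Lebesgue measure.

In one dimension ([interval_net]), to approximate the intervals whose mass is
at least [h] and at most a constant multiple of [h], take the quantiles of the
multiples of [1 / N] with [N] of order [1 / (h eps)].  Rounding both endpoints
outwards moves each by at most one grid step, which is a small fraction of
[eps h].  The left endpoint has [N] possible positions; once it is chosen, the
right one is within [O(1 / eps)] grid steps of it, because the mass is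
[O(h)].  This gives a net of size [O(1 / (h eps ^ 2))].

In the plane ([rectangle_net_at_width]), consider the rectangles of mass about
[s] whose horizontal side has mass about [w].  Their vertical side has mass
about [s / w], and the products of the two nets number
[O(1 / (w eps ^ 2)) * O(w / (s eps ^ 2)) = O(1 / (s eps ^ 4))], whatever [w]
is.  Rounding outwards makes the old rectangle a subset of the new one up to a
null set, so that the mass of the symmetric difference is the mere difference
of two products ([symdiff_product]).

A horizontal side has mass between [s / 2] and [1], so it is enough to let [w]
run over the powers [expR (- k)] that are at least [s / 2]; there are
[O(ln (2 / s))] of them, hence the logarithmic factor. *)

Require Import Defs.
From HB Require Import structures.
From mathcomp Require Import all_boot all_order all_algebra.
From mathcomp Require Import finmap ring lra.
From mathcomp Require Import all_classical all_reals all_analysis.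
Import Order.TTheory GRing.Theory Num.Theory.
Import numFieldNormedType.Exports.
Local Open Scope classical_set_scope.
Local Open Scope ring_scope.
(** * Distribution functions on the extended line *)

Section marginal_instances.
Context {R : realType}.

HB.instance Definition _ :=
  @isMeasurableFun.Build _ _ R R idfun (@measurable_id _ _ setT).
HB.instance Definition _ :=
  @isMeasurableFun.Build _ _ (R * R)%type R fst measurable_fst.
HB.instance Definition _ :=
  @isMeasurableFun.Build _ _ (R * R)%type R snd measurable_snd.

End marginal_instances.

Section line.
Context {R : realType}.
Implicit Types (mu : probability R R) (x y t : R) (p q : \bar R).

(** A side of a rectangle: infinite endpoints give rays and the whole line. *)
Definition icc p q : set R := [set t | (p <= t%:E <= q)%E].

(** The distribution function of [mu], extended by its limits 0 and 1 to the
infinite endpoints, so that all sides of rectangles are treated alike. *)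
Definition level mu p : R := fine (mu [set t | (t%:E <= p)%E]).

Lemma measurable_ray_le p : measurable [set t : R | (t%:E <= p)%E].
Proof.
by rewrite -[X in measurable X]setTI; apply: measurable_lee.
Qed.

Lemma measurable_ray_ge p : measurable [set t : R | (p <= t%:E)%E].
Proof.
by rewrite -[X in measurable X]setTI; apply: measurable_lee.
Qed.

Lemma measurable_icc p q : measurable (icc p q).
Proof.
rewrite (_ : icc p q = [set t | (p <= t%:E)%E] `&` [set t | (t%:E <= q)%E]).
  by apply: measurableI; [exact: measurable_ray_ge | exact: measurable_ray_le].
by apply/seteqP; split=> t /= => [/andP|] [? ?] //; apply/andP.
Qed.

Lemma levelE mu p : (level mu p)%:E = mu [set t | (t%:E <= p)%E].
Proof.
by rewrite /level fineK// fin_num_measure//; exact: measurable_ray_le.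
Qed.

Lemma level_homo mu : {homo level mu : p q / (p <= q)%E >-> p <= q}.
Proof.
move=> p q pq; rewrite -lee_fin !levelE; apply: le_measure.
- by rewrite inE; exact: measurable_ray_le.
- by rewrite inE; exact: measurable_ray_le.
- by move=> t /= /le_trans; apply.
Qed.

Lemma levelNy mu : level mu -oo = 0.
Proof.
apply: EFin_inj; rewrite levelE (_ : mkset _ = set0) ?measure0//.
by apply/seteqP; split=> t //=; rewrite leNgt ltNyr.
Qed.

Lemma levely mu : level mu +oo = 1.
Proof.
apply: EFin_inj; rewrite levelE (_ : mkset _ = setT) ?probability_setT//.
by apply/seteqP; split=> t //= _; rewrite leey.
Qed.

Lemma level_fin mu x : (level mu x%:E)%:E = cdf (idfun : {RV mu >-> R}) x.
Proof.
by rewrite levelE; congr (mu _).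
Qed.

Lemma level_itv01 mu p : 0 <= level mu p <= 1.
Proof.
rewrite -{1}(levelNy mu) level_homo ?leNye//=.
by rewrite -[X in _ <= X](levely mu) level_homo ?leey.
Qed.

Definition continuous_level mu := continuous (fun x => level mu x%:E).

(** An atom at [r] would be a lower bound for the increments of the
distribution function to the left of [r]. *)
Lemma continuous_level_atomless mu :
  continuous_level mu -> forall p, mu [set t | t%:E = p] = 0%E.
Proof.
move=> cmu [r||]; last 2 first.
- by rewrite (_ : mkset _ = set0) ?measure0//; apply/seteqP; split.
- by rewrite (_ : mkset _ = set0) ?measure0//; apply/seteqP; split.
rewrite (_ : mkset _ = [set r]); last first.
  by apply/seteqP; split=> t /= => [[]|->].
apply/eqP; rewrite eq_le measure_ge0 andbT.
have jump y : y < r -> (mu [set r] <= (level mu r%:E - level mu y%:E)%:E)%E.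
  move=> yr; rewrite EFinB !levelE leeBrDl ?fin_num_measure//; last first.
    exact: measurable_ray_le.
  rewrite -measureU//=; last 2 first.
  - exact: measurable_ray_le.
  - apply/seteqP; split=> t //= -[+ tr]; rewrite tr lee_fin => ry.
    by move: yr; rewrite ltNge ry.
  apply: le_measure; rewrite ?inE//.
  - by apply: measurableU => //; exact: measurable_ray_le.
  - exact: measurable_ray_le.
  - by move=> t /= [|->//]; rewrite !lee_fin => /le_trans; apply; exact: ltW.
apply/lee_addgt0Pr => e e0; rewrite add0e.
have [d /= d0 hd] := (@cvgrPdist_lt _ _ _ _ _ _ _).1 (cmu r) _ e0.
pose y := r - d / 2.
have yr : y < r by rewrite /y; lra.
apply: (le_trans (jump y yr)); rewrite lee_fin; apply: (le_trans (ler_norm _)).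
by apply/ltW/hd => /=; rewrite /y opprB addrC subrK gtr0_norm; lra.
Qed.

Lemma icc_mass mu p q : continuous_level mu -> (p <= q)%E ->
  mu (icc p q) = (level mu q - level mu p)%:E.
Proof.
move=> cmu pq.
have null := continuous_level_atomless mu cmu p.
have mnull : measurable [set t : R | t%:E = p].
  rewrite (_ : mkset _ = icc p p); first exact: measurable_icc.
  apply/seteqP; split=> t /=; rewrite /icc/=; first by move=> ->; rewrite lexx.
  by move=> ?; apply/eqP; rewrite eq_le andbC.
pose B := [set t : R | (t%:E <= p)%E].
have mB : measurable B by exact: measurable_ray_le.
have mI := measurable_icc p q.
have mBI : measurable (B `\` icc p q) by exact: measurableD.
have BE : mu (B `\` icc p q) = mu B.
  rewrite [in RHS](_ : B = (B `\` icc p q) `|` [set t : R | t%:E = p]).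
    by rewrite measureU0.
  apply/seteqP; split=> t; rewrite /B /icc /=.
    move=> tp; have [->|tp'] := eqVneq (t%:E) p; [by right|left; split=> //].
    by rewrite leNgt lt_neqAle tp' tp.
  by move=> [[]//|->]; rewrite lexx.
have : mu [set t : R | (t%:E <= q)%E] = (mu (icc p q) + mu B)%E.
  rewrite -BE -measureU//; last by rewrite setDE setICA setICr setI0.
  congr (mu _); apply/seteqP; split=> t; rewrite /B /icc/=.
    move=> tq; have [pt|tp] := leP p t%:E; first by left; rewrite tq.
    by right; split=> //; exact: ltW.
  by move=> [/andP[]//|[/le_trans + _]]; apply.
rewrite -!levelE EFinB => ->.
by rewrite addeK.
Qed.

(** A right end for the intermediate value theorem, and a line along which the
joint distribution function does not vanish identically. *)
Lemma level_near1 mu u : u < 1 -> exists x, u <= level mu x%:E.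
Proof.
move=> u1; have u1' : 0 < 1 - u by lra.
have /fine_cvg/cvgrPdist_lt/(_ _ u1')[M [_ hM]] :=
  cvg_cdfy1 (idfun : {RV mu >-> R}).
exists (M + 1); have /hM : M < M + 1 by lra.
rewrite /= -level_fin /= => /(le_lt_trans (ler_norm _)); lra.
Qed.

(** Levels 0 and 1 are taken at the infinite endpoints, all others at real
points by the intermediate value theorem. *)
Lemma quantile mu : continuous_level mu ->
  forall u, 0 <= u <= 1 -> exists p, level mu p = u.
Proof.
move=> cmu u /andP[u0 u1].
have [->|u0'] := eqVneq u 0; first by exists -oo%E; rewrite levelNy.
have [->|u1'] := eqVneq u 1; first by exists +oo%E; rewrite levely.
have {u0 u0'}ugt0 : 0 < u by rewrite lt_neqAle eq_sym u0'.
have {u1 u1'}ult1 : u < 1 by rewrite lt_neqAle u1'.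
have [a ale] : exists a, level mu a%:E <= u.
  have /fine_cvg/cvgrPdist_lt/(_ _ ugt0)[M [_ hM]] :=
    cvg_cdfNy0 (idfun : {RV mu >-> R}).
  exists (M - 1); have /hM : M - 1 < M by lra.
  by rewrite /= -level_fin /= sub0r normrN => /(le_lt_trans (ler_norm _))/ltW.
have [b bge] := level_near1 mu u ult1.
have [ab|ba] := leP a b; last first.
  exists a%:E; apply/eqP; rewrite eq_le ale/= (le_trans bge)//.
  by apply: level_homo; rewrite lee_fin ltW.
have [||c _ <-] := @IVT R (fun x => level mu x%:E) a b u ab.
- exact: continuous_subspaceT.
- by rewrite ge_min ale/= le_max bge orbT.
- by exists c%:E.
Qed.

End line.

(** * Nets of intervals *)

Section net.
Context {R : realType}.
Implicit Types (mu : probability R R) (x y t : R) (p q : \bar R).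

(** The inequality between levels bounds the positions of the endpoints only
up to a null interval: when [p < p'], the distribution function is constant
between them. *)
Lemma null_overhang_left mu p q p' : continuous_level mu ->
  level mu p' <= level mu p -> mu (icc p q `&` [set t | (t%:E <= p')%E]) = 0%E.
Proof.
move=> cmu le_level.
have [pp'|p'p] := leP p p'; last first.
  rewrite (_ : _ `&` _ = set0) ?measure0//; apply/seteqP; split=> t //=.
  by rewrite /icc/= => -[/andP[/le_trans + _]] => /[apply]; rewrite leNgt p'p.
apply: (@subset_measure0 _ _ _ _ _ (icc p p')).
- by apply: measurableI; [exact: measurable_icc | exact: measurable_ray_le].
- exact: measurable_icc.
- by move=> t; rewrite /icc/= => -[/andP[-> _] ->].
- apply: (etrans (icc_mass mu _ _ cmu pp')); congr EFin; apply/eqP.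
  by rewrite subr_eq0 eq_le le_level level_homo.
Qed.

Lemma null_overhang_right mu p q q' : continuous_level mu ->
  level mu q <= level mu q' -> mu (icc p q `&` [set t | (q' <= t%:E)%E]) = 0%E.
Proof.
move=> cmu le_level.
have [q'q|qq'] := leP q' q; last first.
  rewrite (_ : _ `&` _ = set0) ?measure0//; apply/seteqP; split=> t //=.
  rewrite /icc/= => -[/andP[_ tq] q't].
  by move: qq'; rewrite ltNge (le_trans q't tq).
apply: (@subset_measure0 _ _ _ _ _ (icc q' q)).
- by apply: measurableI; [exact: measurable_icc | exact: measurable_ray_ge].
- exact: measurable_icc.
- by move=> t; rewrite /icc/= => -[/andP[_ ->] ->].
- apply: (etrans (icc_mass mu _ _ cmu q'q)); congr EFin; apply/eqP.
  by rewrite subr_eq0 eq_le le_level level_homo.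
Qed.

Lemma null_overhang mu p q p' q' : continuous_level mu ->
  level mu p' <= level mu p -> level mu q <= level mu q' ->
  mu (icc p q `\` icc p' q') = 0%E.
Proof.
move=> cmu lp lq.
have mL : measurable (icc p q `&` [set t : R | (t%:E <= p')%E]).
  by apply: measurableI; [exact: measurable_icc | exact: measurable_ray_le].
have mR : measurable (icc p q `&` [set t : R | (q' <= t%:E)%E]).
  by apply: measurableI; [exact: measurable_icc | exact: measurable_ray_ge].
apply: (subset_measure0 (B := (icc p q `&` [set t | (t%:E <= p')%E])
    `|` (icc p q `&` [set t | (q' <= t%:E)%E]))).
- by apply: measurableD; exact: measurable_icc.
- exact: measurableU.
- move=> t [It nIt]; have [p't|tp'] := leP p' t%:E; last first.
    by left; split=> //=; exact: ltW.
  have [q't|tq'] := leP q' t%:E; first by right.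
  by case: nIt; rewrite /icc/= p't ltW.
- have mR0 := null_overhang_right mu p q q' cmu lq.
  exact: etrans (measureU0 mL mR mR0) (null_overhang_left mu p q p' cmu lp).
Qed.

(** The candidates start at one of [N] grid points and span fewer than [D] grid
steps.  Those that run over the last grid point get an arbitrary right end,
and the filter keeps only nondegenerate intervals. *)
Definition grid_intervals (Q : R -> \bar R) (N D : nat)
    : seq (\bar R * \bar R) :=
  [seq r <- [seq (Q (i%:R / N%:R), Q ((i + d)%N%:R / N%:R))
              | i <- iota 0 N, d <- iota 0 D] | (r.1 < r.2)%E].

(** The factor [1 + eps / 3] is chosen because its square is at most [1 + eps]:
a rectangle is enlarged along both axes. *)
Lemma interval_net mu (h L eps : R) : continuous_level mu ->
  0 < h -> 1 <= L -> 0 < eps < 1 -> h <= 1 ->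
  exists net : seq (\bar R * \bar R),
    [/\ {in net, forall r, (r.1 < r.2)%E},
        (size net)%:R <= 70 * L * h^-1 * eps^-1 ^+ 2 &
        forall p q, h <= level mu q - level mu p <= L * h ->
        exists2 r, r \in net &
          mu (icc p q `\` icc r.1 r.2) = 0%E /\
          (mu (icc r.1 r.2) <=
             ((1 + eps / 3) * (level mu q - level mu p))%:E)%E].
Proof.
move=> cmu h0 L1 /andP[e0 e1] h1.
have [Q QE] : exists Q, forall u, 0 <= u <= 1 -> level mu (Q u) = u.
  have /choice[Q hQ] : forall u, exists p, 0 <= u <= 1 -> level mu p = u.
    move=> u; have [/(quantile mu cmu)[p pu]|u01] := boolP (0 <= u <= 1).
      by exists p.
    by exists -oo%E.
  by exists Q.
(* Two grid steps weigh [2 / N < h * eps / 3], the excess that the factor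
   [1 + eps / 3] leaves to an interval of mass [h]. *)
pose N := (Num.truncn (6 / (h * eps))).+1.
(* Up to two steps of rounding, an interval spans at most
   [N * (L * h) <= 7 * L / eps] steps. *)
pose D := (Num.truncn (9 * L / eps)).+1.
have he0 : 0 < h * eps by exact: mulr_gt0.
have NR0 : 0 < N%:R :> R by rewrite ltr0n.
have NE : N%:R = (Num.truncn (6 / (h * eps)))%:R + 1 :> R by rewrite natr1.
have DE : D%:R = (Num.truncn (9 * L / eps))%:R + 1 :> R by rewrite natr1.
have Nge : 6 < N%:R * (h * eps) by rewrite -ltr_pdivrMr// truncnS_gt.
have he1 : h * eps <= 1 by nra.
have Nle : N%:R * (h * eps) <= 7.
  have : (Num.truncn (6 / (h * eps)))%:R <= 6 / (h * eps).
    by rewrite truncn_le divr_ge0// ltW.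
  by rewrite ler_pdivlMr// => ?; rewrite NE mulrDl mul1r; lra.
have Dle : D%:R * eps <= 10 * L.
  have : (Num.truncn (9 * L / eps))%:R <= 9 * L / eps.
    by rewrite truncn_le divr_ge0//; [lra|exact: ltW].
  by rewrite ler_pdivlMr// => ?; rewrite DE mulrDl mul1r; lra.
exists (grid_intervals Q N D); split.
- by move=> p; rewrite mem_filter => /andP[].
- have : (size (grid_intervals Q N D) <= N * D)%N.
    rewrite size_filter (leq_trans (count_size _ _))//.
    by rewrite size_allpairs !size_iota.
  rewrite -(ler_nat R) natrM => /le_trans; apply.
  have : (N%:R * (h * eps)) * (D%:R * eps) <= 7 * (10 * L).
    by apply: ler_pM => //; rewrite mulr_ge0// ltW.
  have -> : N%:R * (h * eps) * (D%:R * eps) =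
    N%:R * D%:R * (h * eps ^+ 2) by ring.
  rewrite -ler_pdivlMr; last by rewrite mulr_gt0// exprn_gt0.
  move=> /le_trans; apply; 
  rewrite [leLHS](_ : _ = 70 * L * h^-1 * eps^-1 ^+ 2)//.
  by field; rewrite !gt_eqF.
- move=> p q /andP[hpq pqL].
  set u := level mu p in hpq pqL *; set v := level mu q in hpq pqL *.
  have /andP[u0 u1] : 0 <= u <= 1 := level_itv01 mu p.
  have /andP[v0 v1] : 0 <= v <= 1 := level_itv01 mu q.
  (* The minimum with [N] matters when [v = 1]: the successor would then point
     beyond the grid. *)
  pose i := Num.truncn (u * N%:R); pose j := minn N (Num.truncn (v * N%:R)).+1.
  have iu : i%:R <= u * N%:R by rewrite truncn_le mulr_ge0// ltW.
  have ui : u * N%:R < i%:R + 1 by rewrite natr1 truncnS_gt.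
  have uvN : u * N%:R < v * N%:R by rewrite ltr_pM2r//; lra.
  have vj : v * N%:R <= j%:R.
    rewrite /j /minn; case: ifP => _; last by apply/ltW/truncnS_gt.
    by rewrite ler_piMl// ltW.
  have jv : j%:R <= v * N%:R + 1.
    have : (j <= (Num.truncn (v * N%:R)).+1)%N by exact: geq_minr.
    rewrite -(ler_nat R) -natr1 => /le_trans; apply.
    by rewrite lerD2r truncn_le mulr_ge0// ltW.
  have jN : (j <= N)%N by exact: geq_minl.
  have ij : (i < j)%N by rewrite -(ltr_nat R); lra.
  have gap : j%:R - i%:R <= N%:R * (v - u) + 2 by lra.
  have gapD : (j - i < D)%N.
    rewrite -(ltr_nat R) natrB ?(ltnW ij)//.
    apply: le_lt_trans (truncnS_gt (9 * L / eps)).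
    rewrite ler_pdivlMr//.
    have : N%:R * (v - u) * eps <= N%:R * (L * h) * eps.
      by rewrite ler_pM2r// ler_pM2l.
    have : N%:R * (h * eps) * L <= 7 * L by rewrite ler_pM2r//; lra.
    have : (j%:R - i%:R) * eps <= (N%:R * (v - u) + 2) * eps by rewrite ler_pM2r.
    lra.
  have levi : level mu (Q (i%:R / N%:R)) = i%:R / N%:R.
    apply: QE; rewrite divr_ge0//= ler_pdivrMr// mul1r ler_nat//.
    by rewrite (leq_trans (ltnW ij)).
  have levj : level mu (Q (j%:R / N%:R)) = j%:R / N%:R.
    by apply: QE; rewrite divr_ge0//= ler_pdivrMr// mul1r ler_nat//.
  pose r := (Q (i%:R / N%:R), Q (j%:R / N%:R)).
  have r12 : (r.1 < r.2)%E.
    rewrite ltNge; apply/negP => /(level_homo mu); rewrite /= levi levj.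
    by rewrite ler_pM2r ?invr_gt0// ler_nat leqNgt ij.
  exists r.
  + rewrite mem_filter r12 andTb; apply/allpairsP; exists (i, (j - i)%N); split.
    * by rewrite mem_iota (leq_trans ij).
    * by rewrite mem_iota.
    * by rewrite /= subnKC// ltnW.
  + split.
      apply: null_overhang => //=; rewrite ?levi ?levj.
        by rewrite ler_pdivrMr.
      by rewrite ler_pdivlMr.
    rewrite icc_mass ?(ltW r12)// lee_fin /= levi levj.
    rewrite -mulrBl ler_pdivrMr//; apply: (le_trans gap).
    have : N%:R * (h * eps) <= N%:R * ((v - u) * eps).
      by rewrite ler_pM2l// ler_pM2r.
    lra.
Qed.
End net.

(** * Products of independent marginals *)

Section plane.
Context {R : realType}.
Implicit Types (mu : probability R R) (F : probability (R * R)%type R).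
Implicit Types (p q : \bar R).

Definition marg1 F : probability R R :=
  distribution F (fst : {mfun (R * R)%type >-> R}).
Definition marg2 F : probability R R :=
  distribution F (snd : {mfun (R * R)%type >-> R}).

Lemma continuous_level_scale mu (c : R) : 0 < c ->
  continuous (fun x : R => (level mu x%:E * c)%:E) -> continuous_level mu.
Proof.
move=> c0 cmu x.
have -> : (fun x => level mu x%:E) =
    (fun x => fine (level mu x%:E * c)%:E * c^-1).
  by apply/funext => y /=; rewrite mulfK// gt_eqF.
by apply: cvgMl; apply: (fine_cvg (cmu x)).
Qed.

Lemma joint_cdf_level F x y : independent_marginals F ->
  joint_cdf F (x, y) = (level (marg1 F) x%:E * level (marg2 F) y%:E)%:E.
Proof.
by move=> indF; rewrite /joint_cdf indF//= EFinM !levelE.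
Qed.

(** Along a horizontal line at a height where the second marginal has positive
level, the joint distribution function is a positive multiple of the first
marginal one. *)
Lemma continuous_marg1 F : continuous_distribution F ->
  independent_marginals F -> continuous_level (marg1 F).
Proof.
move=> cF indF; have half : 2^-1 < 1 :> R by lra.
have [y hy] := level_near1 (marg2 F) _ half.
apply: (@continuous_level_scale _ (level (marg2 F) y%:E)); first lra.
move=> x; under eq_fun do rewrite -joint_cdf_level//.
apply: (cvg_comp (fun x => (x, y)) (joint_cdf F) _ (cF (x, y))).
exact: (cvg_pair cvg_id (cvg_cst _)).
Qed.

Lemma continuous_marg2 F : continuous_distribution F ->
  independent_marginals F -> continuous_level (marg2 F).
Proof.
move=> cF indF; have half : 2^-1 < 1 :> R by lra.
have [x hx] := level_near1 (marg1 F) _ half.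
apply: (@continuous_level_scale _ (level (marg1 F) x%:E)); first lra.
move=> y; under eq_fun do rewrite mulrC -joint_cdf_level//.
apply: (cvg_comp (fun y => (x, y)) (joint_cdf F) _ (cF (x, y))).
exact: (cvg_pair (cvg_cst _) cvg_id).
Qed.

Lemma rectangleE p q p' q' : rectangle p q p' q' = icc p q `*` icc p' q'.
Proof. by []. Qed.

(** The old rectangle exceeds the new one by a null set only, so the symmetric
difference weighs as much as the mass gained. *)
Lemma symdiff_product F (I I' J J' : set R) (a a' b b' : R) :
  independent_marginals F ->
  measurable I -> measurable I' -> measurable J -> measurable J' ->
  marg1 F I = a%:E -> marg1 F I' = a'%:E ->
  marg2 F J = b%:E -> marg2 F J' = b'%:E ->
  marg1 F (I `\` I') = 0%E -> marg2 F (J `\` J') = 0%E ->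
  (F ((I `*` J) `+` (I' `*` J')) <= (a' * b' - a * b)%:E)%E.
Proof.
move=> indF mI mI' mJ mJ' Ia Ia' Jb Jb' nullI nullJ.
have mA : measurable (I `*` J) by exact: measurableX.
have mA' : measurable (I' `*` J') by exact: measurableX.
have mX : measurable ((I `\` I') `*` [set: R]).
  by apply: measurableX => //; exact: measurableD.
have mY : measurable ([set: R] `*` (J `\` J')).
  by apply: measurableX => //; exact: measurableD.
have nullX : F ((I `\` I') `*` setT) = 0%E.
  by rewrite indF//; [rewrite [X in (X * _)%E]nullI mul0e|exact: measurableD].
have nullY : F (setT `*` (J `\` J')) = 0%E.
  by rewrite indF//; [rewrite [X in (_ * X)%E]nullJ mule0|exact: measurableD].
have null : F ((I `*` J) `\` (I' `*` J')) = 0%E.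
  apply: (subset_measure0
    (B := ((I `\` I') `*` setT) `|` (setT `*` (J `\` J')))).
  - exact: measurableD.
  - by apply: measurableU; apply: measurableX => //; exact: measurableD.
  - move=> [x y] [/= [Ix Jy] nA'].
    have [I'x|nI'x] := pselect (I' x); last by left.
    by right; split=> //; split=> // J'y; exact: nA'.
  - exact: etrans (measureU0 mX mY nullY) nullX.
have FA : F (I `*` J) = (a * b)%:E.
  by rewrite indF// [X in (X * _)%E]Ia [X in (_ * X)%E]Jb.
have FA' : F (I' `*` J') = (a' * b')%:E.
  by rewrite indF// [X in (X * _)%E]Ia' [X in (_ * X)%E]Jb'.
have cover : (F ((I `*` J) `+` (I' `*` J')) <=
    F ((I `*` J) `\` (I' `*` J')) + F ((I' `*` J') `\` (I `*` J)))%E.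
  by apply: measureU2; exact: measurableD.
apply: (le_trans cover); rewrite null add0e EFinB -FA -FA'.
have -> : F (I `*` J) = F ((I' `*` J') `&` (I `*` J)).
  rewrite setIC -[RHS]add0e -null; exact: measureDI.
have -> : F (I' `*` J') = (F ((I' `*` J') `\` (I `*` J)) +
    F ((I' `*` J') `&` (I `*` J)))%E by exact: measureDI.
by rewrite addeK// fin_num_measure//; exact: measurableI.
Qed.

End plane.

(** * Nets of rectangles *)

Section rectangle_net.
Context {R : realType}.
Implicit Types (F : probability (R * R)%type R).
Implicit Types (p q : \bar R).

(** If the horizontal side has mass [a] with [w / 4 <= a <= w], the mass of the
vertical one lies between [s / (2 * w)] and [4 * s / w], that is within a factor
[8]; the hypothesis [s <= 2 * w] says that the lower bound is at most [1].  The
factor [w] cancels in the product of the sizes of the two nets, with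
[(70 * 4 * 4) * (70 * 8 * 2) = 1120 ^+ 2]. *)
Lemma rectangle_net_at_width F (s eps w : R) :
  continuous_distribution F -> independent_marginals F ->
  0 < s < 1 -> 0 < eps < 1 -> 0 < w <= 1 -> s <= 2 * w ->
  exists net : seq (set (R * R)),
    [/\ forall A', A' \in net -> rectangles A',
        (size net)%:R <= 1120 ^+ 2 * s^-1 * eps ^- 4 &
        forall p q p' q', (p < q)%E -> (p' < q')%E ->
          let a := level (marg1 F) q - level (marg1 F) p in
          w / 4 <= a <= w ->
          ((s / 2)%:E < F (rectangle p q p' q') <= s%:E)%E ->
          exists2 A', A' \in net &
            (F (rectangle p q p' q' `+` A') <=
               eps%:E * F (rectangle p q p' q'))%E].
Proof.
move=> cF indF /andP[s0 s1] eps01 /andP[w0 w1] sw.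
have c1 := continuous_marg1 F cF indF; have c2 := continuous_marg2 F cF indF.
have /andP[e0 e1] := eps01.
have [|||netX [ltX sizeX coverX]] := interval_net _ (w / 4) 4 eps c1 _ _ eps01;
  try lra.
have h0 : 0 < s / (2 * w) by rewrite divr_gt0//; lra.
have h1 : s / (2 * w) <= 1 by rewrite ler_pdivrMr ?mul1r//; lra.
have [|netY [ltY sizeY coverY]] :=
  interval_net _ (s / (2 * w)) 8 eps c2 h0 _ eps01 h1; first lra.
exists [seq rectangle r.1 r.2 r'.1 r'.2 | r <- netX, r' <- netY]; split.
- move=> _ /allpairsP[[r r'] [/= rX rY ->]].
  by exists r.1, r.2, r'.1, r'.2; split=> //; [exact: ltX|exact: ltY].
- rewrite size_allpairs natrM; apply: (le_trans (ler_pM _ _ sizeX sizeY)) => //.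
  rewrite le_eqVlt; apply/orP; left; apply/eqP; field.
  by rewrite !gt_eqF.
- move=> p q p' q' pq p'q' a /andP[wa aw].
  set b := level (marg2 F) q' - level (marg2 F) p'.
  have Ia : marg1 F (icc p q) = a%:E by rewrite icc_mass// ltW.
  have Jb : marg2 F (icc p' q') = b%:E by rewrite icc_mass// ltW.
  have FA : F (rectangle p q p' q') = (a * b)%:E.
    rewrite rectangleE indF; try exact: measurable_icc.
    by rewrite [X in (X * _)%E]Ia [X in (_ * X)%E]Jb.
  rewrite FA lee_fin lte_fin => /andP[sab abs].
  have a0 : 0 < a by lra.
  have b0 : 0 < b by rewrite -(pmulr_rgt0 _ a0); lra.
  have aLw : a * b <= w * b by rewrite ler_pM2r.
  have wLa : w * b <= 4 * a * b by rewrite ler_pM2r//; lra.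
  have [|r rX [nullX massX]] := coverX p q; first by rewrite -/a; lra.
  have [|r' rY [nullY massY]] := coverY p' q'.
    rewrite -/b; apply/andP; split; first by rewrite ler_pdivrMr; lra.
    by rewrite mulrA ler_pdivlMr; lra.
  exists (rectangle r.1 r.2 r'.1 r'.2).
    by apply/allpairsP; exists (r, r').
  have Ia' := icc_mass _ _ _ c1 (ltW (ltX _ rX)).
  have Jb' := icc_mass _ _ _ c2 (ltW (ltY _ rY)).
  have a'0 : 0 <= level (marg1 F) r.2 - level (marg1 F) r.1.
    by rewrite -lee_fin -Ia'.
  have b'0 : 0 <= level (marg2 F) r'.2 - level (marg2 F) r'.1.
    by rewrite -lee_fin -Jb'.
  move: massX massY; rewrite Ia' Jb' !lee_fin -/a -/b => massX massY.
  apply: le_trans (symdiff_product F _ _ _ _ _ _ _ _ indF _ _ _ _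
    Ia Ia' Jb Jb' nullX nullY) _; try exact: measurable_icc.
  rewrite -EFinM lee_fin; have := ler_pM a'0 b'0 massX massY.
  have ab0 : 0 < a * b by exact: mulr_gt0.
  have : (1 + eps / 3) ^+ 2 * (a * b) <= (1 + eps) * (a * b).
    by rewrite ler_pM2r//; nra.
  lra.
Qed.

Lemma size_flatten_map_le {T : Type} {I : eqType} (f : I -> seq T) ks (B : R) :
  {in ks, forall k, (size (f k))%:R <= B} ->
  (size (flatten (map f ks)))%:R <= (size ks)%:R * B.
Proof.
elim: ks => [|k ks IH] fB /=; first by rewrite mul0r.
rewrite size_cat natrD -nat1r mulrDl mul1r lerD// ?fB ?mem_head// IH// => i ki.
by rewrite fB// in_cons ki orbT.
Qed.

Lemma card_fset_set_seq {T : choiceType} (s : seq T) :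
  (#|` fset_set [set` s]| <= size s)%N.
Proof.
rewrite (_ : [set` s] = [set` [fset x in s]%fset]); last first.
  by apply/seteqP; split=> x /=; rewrite inE.
by rewrite set_fsetK card_fseq size_undup.
Qed.

Lemma expR_half_le2 : expR 2^-1 <= 2 :> R.
Proof.
have half : 2^-1 <= expR (- 2^-1) :> R.
  by apply: le_trans (expR_ge1Dx _); lra.
rewrite -[expR _]invrK -expRN -[leRHS]invrK.
by rewrite lef_pV2 ?posrE ?expR_gt0 ?invr_gt0.
Qed.

(** [expR 1] is the ratio of consecutive widths, and [4] the explicit bound on
it that enters the constants. *)
Lemma expR1_le4 : expR 1 <= 4 :> R.
Proof.
have -> : expR 1 = expR 2^-1 * expR 2^-1 :> R.
  by rewrite -expRD; congr expR; lra.
have -> : 4 = 2 * 2 :> R by lra.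
by rewrite ler_pM ?expR_ge0 ?expR_half_le2.
Qed.

End rectangle_net.

(** * The net at all widths *)

Theorem theorem1 (R : realType) :
  exists C : R,
    forall F : probability (R * R)%type R,
      continuous_distribution F -> independent_marginals F ->
      forall s eps : R, 0 < s < 1 -> 0 < eps < 1 ->
        exists Rapp : set (set (R * R)),
          [/\ Rapp `<=` @rectangles R,
              forall A, rectangles_at_scale F s A ->
                exists2 A', Rapp A' & (F (A `+` A') <= eps%:E * F A)%E,
              finite_set Rapp &
              (#|` fset_set Rapp|%fset)%:R <= C * s^-1 * eps ^- 4 * ln (2 / s)].
Proof.
exists (3 * 1120 ^+ 2) => F cF indF s eps s01 eps01.
have /andP[s0 s1] := s01; have /andP[e0 e1] := eps01.
pose K := (Num.truncn (ln (2 / s))).+1.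
have s2_gt0 : 0 < 2 / s by rewrite divr_gt0.
have e4 := expR1_le4 (R := R).
have s2_ge2 : 2 <= 2 / s by rewrite ler_pdivlMr//; lra.
(* Absorbs the rounding: [K <= ln (2 / s) + 1 <= 3 * ln (2 / s)]. *)
have ln_ge : 2^-1 <= ln (2 / s).
  by rewrite -ler_expR lnK ?posrE// (le_trans expR_half_le2).
have widthK k : (k < K)%N ->
    0 < expR (- k%:R : R) <= 1 /\ s <= 2 * expR (- k%:R).
  move=> kK; split; first by rewrite expR_gt0 expR_le1 oppr_le0 ler0n.
  have kln : k%:R <= ln (2 / s).
    by rewrite -truncn_ge_nat//; lra.
  have : expR k%:R <= 2 / s by rewrite -[leRHS]lnK ?posrE// ler_expR.
  by rewrite ler_pdivlMr// expRN -ler_pdivlMl ?expR_gt0// mulrC.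
have /choice[net netP] : forall k, exists net : seq (set (R * R)), (k < K)%N ->
    [/\ forall A', A' \in net -> rectangles A',
        (size net)%:R <= 1120 ^+ 2 * s^-1 * eps ^- 4 &
        forall p q p' q', (p < q)%E -> (p' < q')%E ->
          let a := level (marg1 F) q - level (marg1 F) p in
          expR (- k%:R) / 4 <= a <= expR (- k%:R) ->
          ((s / 2)%:E < F (rectangle p q p' q') <= s%:E)%E ->
          exists2 A', A' \in net &
            (F (rectangle p q p' q' `+` A') <=
               eps%:E * F (rectangle p q p' q'))%E].
  move=> k; have [/widthK[w01 sw]|_] := ltnP k K; last by exists [::].
  have [net netP] := rectangle_net_at_width F s eps _ cF indF s01 eps01 w01 sw.
  by exists net.
pose nets := flatten [seq net k | k <- iota 0 K].
exists [set` nets]; split.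
- move=> A /= /flattenP[_ /mapP[k + ->]]; rewrite mem_iota => /netP[+ _ _].
  exact.
- move=> _ [[p [q [p' [q' [pq p'q' ->]]]]] Fs].
  set a := level (marg1 F) q - level (marg1 F) p.
  have c1 := continuous_marg1 F cF indF.
  have c2 := continuous_marg2 F cF indF.
  have FA : F (rectangle p q p' q') =
      (a * (level (marg2 F) q' - level (marg2 F) p'))%:E.
    rewrite rectangleE indF; try exact: measurable_icc.
    by rewrite [X in (X * _)%E](icc_mass _ _ _ c1 (ltW pq))
      [X in (_ * X)%E](icc_mass _ _ _ c2 (ltW p'q')).
  have /andP[q0 q1] := level_itv01 (marg1 F) q.
  have /andP[p0 p1] := level_itv01 (marg1 F) p.
  have /andP[q'0 q'1] := level_itv01 (marg2 F) q'.
  have /andP[p'0 p'1] := level_itv01 (marg2 F) p'.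
  have a1 : a <= 1 by rewrite /a; lra.
  have a0 : 0 <= a by rewrite subr_ge0 level_homo// ltW.
  have sa : s / 2 < a.
    move: Fs; rewrite FA lte_fin => /andP[/lt_le_trans + _]; apply.
    by rewrite ler_piMr//; lra.
  have agt0 : 0 < a by lra.
  (* The width of index [k] is the least one that is at least [a]. *)
  pose k := Num.truncn (- ln a).
  have lna : 0 <= - ln a by rewrite oppr_ge0 ln_le0.
  have ka : a <= expR (- k%:R).
    by rewrite -[leLHS]lnK ?posrE// ler_expR lerNr truncn_le.
  have ak : expR (- k%:R) / 4 <= a.
    have : expR (- k%:R - 1) <= a.
      rewrite -[leRHS]lnK ?posrE// ler_expR -opprD lerNl natr1.
      exact/ltW/truncnS_gt.
    apply: le_trans; rewrite expRD ler_pM2l ?expR_gt0// expRN.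
    by rewrite lef_pV2 ?posrE ?expR_gt0.
  have kK : (k < K)%N.
    rewrite ltnS truncn_ge_nat//; last lra.
    apply: (le_trans (y := - ln a)); first by rewrite truncn_le.
    rewrite -lnV ?posrE// ler_ln ?posrE ?invr_gt0//.
    by rewrite -[leRHS]invf_div lef_pV2 ?posrE ?divr_gt0// ltW.
  have aw : expR (- k%:R) / 4 <= a <= expR (- k%:R) by apply/andP.
  have [_ _ cover] := netP k kK.
  have [A' A'net FA'] := cover p q p' q' pq p'q' aw Fs.
  exists A' => //=; apply/flattenP; exists (net k) => //.
  by apply: map_f; rewrite mem_iota.
- exact: finite_seq.
- apply: (@le_trans _ _ (size nets)%:R).
    by rewrite ler_nat card_fset_set_seq.
  apply: le_trans (size_flatten_map_le net (iota 0 K)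
    (1120 ^+ 2 * s^-1 * eps ^- 4) _) _.
    by move=> k; rewrite mem_iota => /netP[].
  have Kle : K%:R <= 3 * ln (2 / s).
    have : (Num.truncn (ln (2 / s)))%:R <= ln (2 / s) by rewrite truncn_le; lra.
    by rewrite /K -natr1; lra.
  have := sqr_ge0 (1120 : R); rewrite size_iota.
  (* Abstracting the constant keeps its numeral from being unfolded. *)
  move: (1120 ^+ 2) => c c0.
  have -> : 3 * c * s^-1 * eps ^- 4 * ln (2 / s) =
    3 * ln (2 / s) * (c * s^-1 * eps ^- 4) by ring.
  apply: ler_wpM2r Kle.
  by rewrite mulr_ge0 ?invr_ge0 ?exprn_ge0 ?(ltW e0)// mulr_ge0// invr_ge0 ltW.
Qed.
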